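(* Let $\xi=0$, $\eta_1=1$ and $\eta_2=\zeta=\exp(2\pi i/5)$, where $i=\sqrt{-1}$. Let $\beta$ be a real number with $\beta>2.90332$ such that $\sqrt5\notin\mathbb{Q}(\beta)$, and let $T:\mathcal{X}\to\mathcal{X}$ be the associated rotational beta transformation. Then $(\mathcal{X},T)$ is not a sofic system.
   Context: Let $\mathcal{L}=\mathbb{Z}\eta_1+\mathbb{Z}\eta_2$ be the lattice in $\mathbb{C}$ generated by $\eta_1,\eta_2$, and let $\mathcal{X}=\{\xi+x\eta_1+y\eta_2 : x\in[0,1),\ y\in[0,1)\}$, a fundamental domain of $\mathcal{L}$. The rotational beta transformation $T:\mathcal{X}\to\mathcal{X}$ is $T(z)=\beta\zeta z-d(z)$, where $d(z)$ is the unique element of $\mathcal{L}$ with $\beta\zeta z\in\mathcal{X}+d(z)$. The expansion of $z\in\mathcal{X}$ is the sequence $d_1d_2\dots$ with $d_n=d(T^{n-1}(z))$. $\partial(\mathcal{X})$ denotes the boundary of $\mathcal{X}$. The two open segments of $\partial(\mathcal{X})$ from $\xi+\eta_1$ to $\xi+\eta_1+\eta_2$ and from $\xi+\eta_2$ to $\xi+\eta_1+\eta_2$ lie outside $\mathcal{X}$; for these segments the images by $T$ are defined by an infinitesimally small perturbation, e.g. for the first one takes the image of the segment connecting $\xi+\eta_1(1-\varepsilon)$ and $\xi+\eta_1(1-\varepsilon)+\eta_2$ for an infinitesimally small $\varepsilon>0$ (and similarly for the second). For $n<0$, $T^{n}$ of a set denotes its preimage under $T^{-n}$. Symbolic system: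 let $\mathcal{A}=\{d(z): z\in\mathcal{X}\}$, let $\mathcal{A}^*$ be the set of finite words over $\mathcal{A}$ and $\mathcal{A}^{\mathbb{Z}}$ the set of bi-infinite words. A word $w\in\mathcal{A}^*$ is admissible if it appears (as a block of consecutive letters) in the expansion $d_1d_2\dots$ of some $z\in\mathcal{X}\setminus\bigcup_{n=-\infty}^{\infty}T^n(\partial(\mathcal{X}))$. Let $\mathcal{X}_T=\{(w_j)\in\mathcal{A}^{\mathbb{Z}} : w_jw_{j+1}\cdots w_k \text{ is admissible for all } (j,k)\in\mathbb{Z}^2 \text{ with } j\le k\}$, with the shift $s((w_j))=(w_{j+1})$. The system $(\mathcal{X}_T,s)$, or simply $(\mathcal{X},T)$, is called sofic if there is a finite directed graph $G$ with edges labeled by $\mathcal{A}$ such that for each $w\in\mathcal{X}_T$ there is a bi-infinite path in $G$ labeled $w$, and vice versa (the label sequence of every bi-infinite path in $G$ belongs to $\mathcal{X}_T$). *)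

(* Defs.v *)
From HB Require Import structures.
From mathcomp Require Import all_boot all_order all_algebra.
From mathcomp Require Import all_classical all_reals all_analysis.
From mathcomp Require Import complex.

Set Implicit Arguments.
Unset Strict Implicit.
Unset Printing Implicit Defensive.

Import Order.TTheory GRing.Theory Num.Theory.
Import numFieldNormedType.Exports.

Local Open Scope classical_set_scope.
Local Open Scope ring_scope.
Local Open Scope complex_scope.

(* e^(it) for real t. *)
Definition expi (R : realType) (t : R) : R[i] := cos t +i* sin t.

(* The subfield Q(b) of R: since x / 0 = 0, the predicates closed in the
   sense of [divring_closed] are exactly the subfields of R, and they all
   contain Q. *)
Definition adjoinQ (R : realType) (b : R) : set R :=
  smallest [set K : set R | GRing.divring_closed [pred x in K]] [set b].

(* The topology used on R[i] is the one given by its modulus; MathComp-Analysis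
   attaches it to the alias R[i]^o. *)
Definition boundary (R : realType) (A : set R[i]^o) : set R[i]^o :=
  closure A `\` interior A.

Section RotationalBeta.
Variables (R : realType) (beta : R) (zeta xi eta1 eta2 : R[i]).

Definition lattice : set R[i] :=
  [set m%:~R * eta1 + n%:~R * eta2 | m in [set: int] & n in [set: int]].

Definition fundom : set R[i] :=
  [set xi + x%:C * eta1 + y%:C * eta2 | x in `[0, 1[ & y in `[0, 1[].

(* The lattice element d such that beta * zeta * z lies in fundom + d; it
   exists and is unique as soon as eta1 and eta2 are linearly independent
   over the reals. *)
Definition digit (z : R[i]) : R[i] :=
  xget 0 [set d | lattice d /\ fundom (beta%:C * zeta * z - d)].

Definition T (z : R[i]) : R[i] := beta%:C * zeta * z - digit z.

(* [expansion z n] is the letter d_(n+1) of the expansion d_1 d_2 ... of z. *)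
Definition expansion (z : R[i]) (n : nat) : R[i] := digit (iter n T z).

(* The two open sides of the boundary lying outside [fundom]. *)
Definition outer_side1 : set R[i] :=
  [set xi + eta1 + y%:C * eta2 | y in `]0, 1[].
Definition outer_side2 : set R[i] :=
  [set xi + x%:C * eta1 + eta2 | x in `]0, 1[].

(* The limit of T at z along z - e * eta, e -> 0+. *)
Definition T_perturbed (eta z w : R[i]) : Prop :=
  (fun e : R => T (z - e%:C * eta) : R[i]^o) @ 0^'+ --> (w : R[i]^o).

(* Image of a set by T, where the points of the two outer sides are moved
   infinitesimally inside [fundom], in direction -eta1 (resp. -eta2). *)
Definition T_image (A : set R[i]) : set R[i] :=
  T @` (A `&` fundom)
  `|` [set w | exists2 z, (A `&` outer_side1) z & T_perturbed eta1 z w]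
  `|` [set w | exists2 z, (A `&` outer_side2) z & T_perturbed eta2 z w].

Definition T_power (n : int) (A : set R[i]) : set R[i] :=
  match n with
  | Posz m => iter m T_image A
  | Negz m => fundom `&` iter m.+1 T @^-1` A
  end.

Definition exceptional : set R[i] :=
  \bigcup_(n in [set: int]) T_power n (boundary fundom).

Definition alphabet : set R[i] := digit @` fundom.

Definition admissible (w : seq R[i]) : Prop :=
  exists2 z, (fundom `\` exceptional) z &
  exists m : nat, w = [seq expansion z (m + i)%N | i <- iota 0 (size w)].

(* The word w_j w_(j+1) ... w_k, for j <= k. *)
Definition block (w : int -> R[i]) (j k : int) : seq R[i] :=
  [seq w (j + i%:Z) | i <- iota 0 `|k - j|%N.+1].

Definition subshift : set (int -> R[i]) :=
  [set w | (forall n, alphabet (w n)) /\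
           forall j k : int, j <= k -> admissible (block w j k)].

(* A finite directed graph with labelled edges (multiple edges and loops are
   allowed) has vertex set V, edge set E, and each edge e goes from src e to
   tgt e and bears the label lab e. *)
Definition biinfinite_path (V E : finType) (src tgt : E -> V)
    (p : int -> E) : Prop :=
  forall n : int, tgt (p n) = src (p (n + 1)).

Definition sofic : Prop :=
  exists (V E : finType) (src tgt : E -> V) (lab : E -> R[i]),
    (forall e, alphabet (lab e)) /\
    forall w : int -> R[i],
      subshift w <->
      exists2 p, biinfinite_path src tgt p & forall n, lab (p n) = w n.

End RotationalBeta.

(* Main.v *)
Require Import Defs.
From mathcomp Require Import all_boot all_order all_algebra.
From mathcomp Require Import all_classical all_reals all_analysis.
From mathcomp Require Import complex ring lra zify.

Set Implicit Arguments.
Unset Strict Implicit.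
Unset Printing Implicit Defensive.

Import Order.TTheory GRing.Theory Num.Theory.
Import numFieldNormedType.Exports.

Local Open Scope ring_scope.
Local Open Scope complex_scope.
Local Open Scope classical_set_scope.

(** Write [z = x + y zeta] and [phi = 2 cos (2 pi / 5)], so that
    [zeta^2 = phi zeta - 1] and [phi^2 = 1 - phi].  In the coordinates [(x, y)]
    the transformation [T] is the linear map [(x, y) |-> beta (- y, x + phi y)]
    followed by reduction modulo the integers, and five steps multiply
    differences of points with the same digits by the real number [beta^5].

    Follow the left side [x = 0] of the rhombus under [T].  Take the point
    [2 zeta / beta] of this side, approach it from inside along a ray, and let
    [z_n] be the limit of the [n]-th iterates; its digits are limits of digits
    along the ray.  After [5 j] steps the image of the side is parallel to the
    side again: the points of the rhombus whose expansion starts with the [5 j]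
    limit digits are sent to the right of the line with this direction through
    [z_(5j)] ([ray_word_xcoord]), and images of points of the ray come arbitrarily close
    to this line.  Hence the abscissa [x_(5j)] of [z_(5j)] can be read off from
    the set of continuations of the word of these digits.  In a finite graph
    presenting the subshift, this set of continuations is determined by the set
    of vertices that are reachable by the word, and there are finitely many
    sets of vertices; so [x_(5i) = x_(5j)] for some [i < j]
    ([ray_orbit_collision]).

    On the other hand, [x_(5j) = A_j + phi B_j] with [A_j], [B_j] in the field
    [Q(beta)].  As [sqrt 5 = 2 phi + 1] is not in this field, [B_j] is
    determined by [x_(5j)].  But [B_j] strictly increases with [j]: over five
    steps it is multiplied by [beta^5] and changed by a combination of the
    ordinates of the [z_n] ([coef_xb_step]), which lie in [0, 1], and the
    starting point is such that the first five steps make it large enough for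
    the factor [beta^5] to dominate ([conjugate_growth]).  In terms of the
    automorphism of [Q(beta, sqrt 5)] over [Q(beta)], the conjugates of the
    abscissas escape to infinity.

    The definition of an admissible word involves only points outside the
    images and preimages of the boundary.  The others lie on countably many
    lines in the five directions [zeta^k], so a ray in another direction
    contains countably many of them ([countable_exceptional_ray]).  A point that
    is not exceptional has a whole past of such points, as [T] is onto, and so its
    expansion extends to an element of the subshift ([subshift_through]). *)

(** * Auxiliary facts on real and complex numbers *)

Lemma eq_int_of_dist (R : realType) (x : R) :
  (forall e, 0 < e -> exists m : int, `|x - m%:~R| < e) -> exists m : int, x = m%:~R.
Proof.
move=> H; exists (Num.floor x); apply/eqP; apply: contraT => xn.
have /andP[fx xf] := floor_itv x; rewrite intrD in xf.
have fx' : (Num.floor x)%:~R < x by rewrite lt_neqAle eq_sym xn.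
pose e := Num.min (x - (Num.floor x)%:~R) ((Num.floor x)%:~R + 1 - x).
have [m] : exists m : int, `|x - m%:~R| < e.
  by apply: H; rewrite lt_min; apply/andP; split; lra.
rewrite lt_min !ltr_norml => /andP[/andP[h1 h2] /andP[h3 h4]].
have m1 : (Num.floor x)%:~R < m%:~R :> R by lra.
have m2 : m%:~R < (Num.floor x + 1)%:~R :> R by rewrite intrD; lra.
move: m1 m2; rewrite !ltr_int; lia.
Qed.

(** The norm of [R[i]] takes its values in [R[i]]; this gives the continuity of
    real-linear functionals with an error bound in [R]. *)
Lemma near_real_linear (R : realType) (a b : R) (w : R[i]) (e : R) : 0 < e ->
  \forall u \near (w : R[i]^o),
    `|a * (complex.Re u - complex.Re w) + b * (complex.Im u - complex.Im w)| < e.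
Proof.
move=> e0; pose r := e / (`|a| + `|b| + 1).
have s0 : 0 < `|a| + `|b| + 1 by rewrite ltr_wpDl // addr_ge0.
have r0 : 0 < r by rewrite divr_gt0.
apply/nbhs_ballP; exists r%:C; first by rewrite /= ltcR.
move=> u /=; rewrite -ball_normE /= distrC normc_def ltcR => uw.
have [h1 h2] : `|complex.Re u - complex.Re w| < r /\ `|complex.Im u - complex.Im w| < r.
  move: uw; case: u => u1 u2; case: w => w1 w2 /= uw.
  by split; apply: le_lt_trans uw; rewrite -sqrtr_sqr ler_wsqrtr // ?lerDl ?lerDr sqr_ge0.
apply: le_lt_trans (ler_normD _ _) _; rewrite !normrM.
have E : e = `|a| * r + `|b| * r + r by rewrite /r; field; rewrite gt_eqF.
rewrite E; have := ler_wpM2l (normr_ge0 a) (ltW h1).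
by have := ler_wpM2l (normr_ge0 b) (ltW h2); lra.
Qed.

Lemma floor_frac (R : realType) (x : R) (m : int) :
  (0 <= x - m%:~R < 1) = (m == Num.floor x).
Proof.
apply/idP/eqP => [/andP[h1 h2]|->].
  by apply/esym/floor_def; rewrite intrD; lra.
by have := floor_itv x; rewrite intrD; lra.
Qed.

Lemma nat_lt_expr (R : realType) (c : R) n : 2 <= c -> n%:R < c ^+ n.
Proof.
move=> c2; elim: n => [|n IH]; first by rewrite expr0 ltr01.
have c1 : 1 <= c ^+ n by rewrite exprn_ege1 //; lra.
have : 2 * c ^+ n <= c ^+ n.+1 by rewrite exprS ler_wpM2r //; lra.
by rewrite -natr1; lra.
Qed.

Lemma countable_of_code (S : Type) (A : set S) (K : countType) (P : K -> S -> Prop) :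
  (forall s, A s -> exists k, P k s) ->
  (forall k s s', P k s -> P k s' -> s = s') -> countable A.
Proof.
move=> ex uniq; apply/countable_injP.
have [f fP] : exists f : S -> option K, forall s, A s -> exists2 k, f s = Some k & P k s.
  suff : forall s, exists o : option K, A s -> exists2 k, o = Some k & P k s.
    by move=> /choice[f fP]; exists f.
  move=> s; have [/ex[k Pk]|nA] := pselect (A s); first by exists (Some k) => _; exists k.
  by exists None.
exists (pickle \o f) => s s'; rewrite !inE => /fP[k fk Pk] /fP[k' fk' Pk'] /=.
move=> /(pcan_inj pickleK); rewrite fk fk' => -[E].
by apply: uniq Pk _; rewrite E.
Qed.

(** The closure properties in terms of membership in the set itself, which is
    the form in which they can be applied. *)
Lemma divring_set (R : realType) (K : set R) : GRing.divring_closed [pred x in K] ->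
  [/\ 1 \in K, (forall x y, x \in K -> y \in K -> x - y \in K),
      (forall x y, x \in K -> y \in K -> x / y \in K) &
      (forall x y, x \in K -> y \in K -> x + y \in K)].
Proof.
move=> [K1 KB KV].
have KB' x y : x \in K -> y \in K -> x - y \in K by exact: (KB x y).
have KV' x y : x \in K -> y \in K -> x / y \in K by exact: (KV x y).
split=> // x y Kx Ky; rewrite -[y]opprK; apply: (KB') => //.
by rewrite -sub0r -(subrr x); do 2?apply: (KB').
Qed.

(** * Right limits of integer parts *)

Section RightLimits.
Variable R : realType.

(** The limit of the integer part of [a + s b] as [s] tends to 0 from the
    right. *)
Definition rfloor (a b : R) : int := if b < 0 then Num.ceil a - 1 else Num.floor a.

Lemma rfloor_itv a b : 0 <= a - (rfloor a b)%:~R <= 1.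
Proof.
rewrite /rfloor; case: ifP => _.
  by have := ceil_itv a; rewrite !intrD intrN; lra.
by have := floor_itv a; rewrite intrD; lra.
Qed.

Lemma near_floor a b : \forall s \near (0 : R)^'+, Num.floor (a + s * b) = rfloor a b.
Proof.
rewrite /rfloor; case: ifPn => b0.
  have := ceil_itv a; rewrite !intrD intrN => aI.
  have d0 : 0 < (a - ((Num.ceil a)%:~R - 1)) / - b by rewrite divr_gt0; lra.
  near=> s; apply: floor_def; rewrite !intrD intrN.
  have s0 : 0 < s by near: s; exact: nbhs_right_gt.
  have : s < (a - ((Num.ceil a)%:~R - 1)) / - b by near: s; exact: nbhs_right_lt.
  rewrite ltr_pdivlMr; last by lra.
  have : s * - b > 0 by rewrite mulr_gt0; lra.
  lra.
rewrite -leNgt in b0.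
have := floor_itv a; rewrite !intrD => aI.
have b1 : 0 < b + 1 by lra.
have d0 : 0 < ((Num.floor a)%:~R + 1 - a) / (b + 1) by rewrite divr_gt0; lra.
near=> s; apply: floor_def; rewrite !intrD.
have s0 : 0 < s by near: s; exact: nbhs_right_gt.
have : s < ((Num.floor a)%:~R + 1 - a) / (b + 1) by near: s; exact: nbhs_right_lt.
rewrite ltr_pdivlMr // mulrDr mulr1.
have : s * b >= 0 by rewrite mulr_ge0 // ltW.
lra.
Unshelve. all: by end_near. Qed.

Lemma rfloor_eq (a b : R) (m : int) : m%:~R < a < m%:~R + 1 -> rfloor a b = m.
Proof.
move=> aI; rewrite /rfloor; case: ifP => _; last by apply: floor_def; rewrite intrD; lra.
by rewrite (@ceil_def _ a (m + 1)) ?addrK // intrD; lra.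
Qed.

End RightLimits.

(** * The golden ratio and the fifth root of unity *)

Section Pentagon.
Variable R : realType.
Local Notation c := (cos (2 * pi / 5 : R)).
Local Notation s := (sin (2 * pi / 5 : R)).

Lemma cos_pentagon_gt0 : 0 < c.
Proof. by apply: cos_gt0_pihalf; have := pi_gt0 R; lra. Qed.

Lemma sin_pentagon_gt0 : 0 < s.
Proof. by apply: sin_gt0_pi; have := pi_gt0 R; lra. Qed.

(** For [theta = 2 pi / 5], [3 theta] and [- 2 theta] differ by [2 pi], so that
    [cos (3 theta) = cos (2 theta)].  As a polynomial in the cosine [c] this is
    [(c - 1) (4 c^2 + 2 c - 1) = 0]. *)
Lemma golden_sqr : (2 * c) ^+ 2 = 1 - 2 * c.
Proof.
have c2 : cos (2 * pi / 5 + 2 * pi / 5 : R) = c ^+ 2 - s ^+ 2 by rewrite cosD !expr2.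
have s2 : sin (2 * pi / 5 + 2 * pi / 5 : R) = 2 * s * c by rewrite sinD; ring.
have E : cos (2 * pi / 5 + (2 * pi / 5 + 2 * pi / 5) : R) =
    cos (2 * pi / 5 + 2 * pi / 5 : R).
  have -> : 2 * pi / 5 + (2 * pi / 5 + 2 * pi / 5) =
    - (2 * pi / 5 + 2 * pi / 5) + pi *+ 2 :> R by rewrite mulr2n; lra.
  by rewrite cosD2pi cosN.
rewrite cosD c2 s2 in E; have := cos2Dsin2 (2 * pi / 5 : R) => cs.
have sE : s ^+ 2 = 1 - c ^+ 2 by move: cs; lra.
have {E} E : (c - 1) * (4 * c ^+ 2 + 2 * c - 1) = 0.
  move: E; rewrite sE => E.
  have : c * (c ^+ 2 - (1 - c ^+ 2)) - s ^+ 2 * (2 * c) = c ^+ 2 - (1 - c ^+ 2).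
    by apply: etrans E; ring.
  by rewrite sE => E'; lra.
have c1 : c - 1 != 0.
  by apply/eqP => c1; have := sin_pentagon_gt0; rewrite lt0r => /andP[/negP + _];
    apply; rewrite -sqrf_eq0 sE -[c](subrK 1) c1 add0r expr1n subrr.
by move/eqP: E; rewrite mulf_eq0 (negbTE c1) /= => /eqP E; lra.
Qed.

Lemma expi_pentagon_sqr :
  (expi (2 * pi / 5 : R) ^+ 2 = (2 * c)%:C * expi (2 * pi / 5) - 1)%C.
Proof.
have := cos2Dsin2 (2 * pi / 5 : R) => cs.
by apply/eqP; rewrite eq_complex expr2 /expi /=; apply/andP; split; apply/eqP; lra.
Qed.

End Pentagon.

(** * The transformation in rhombic coordinates *)

Section PentagonalTransformation.

(** The root of unity enters through its quadratic equation over the field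
    generated by the golden ratio. *)
Variables (R : realType) (beta phi : R) (zeta : R[i]).
Hypothesis phi_gt0 : 0 < phi.
Hypothesis phi_sqr : phi ^+ 2 = 1 - phi.
Hypothesis zeta_sqr : zeta ^+ 2 = phi%:C * zeta - 1.
Hypothesis Im_zeta : 0 < complex.Im zeta.
Hypothesis beta_gt : 29 / 10 < beta.

Local Notation Re := complex.Re.
Local Notation Im := complex.Im.
Local Notation rot := (beta%:C * zeta).
Local Notation T := (T beta zeta 0 1 zeta).
Local Notation X := (fundom 0 1 zeta).
Local Notation digit := (digit beta zeta 0 1 zeta).
Local Notation expansion := (expansion beta zeta 0 1 zeta).
Local Notation exceptional := (exceptional beta zeta 0 1 zeta).
Local Notation subshift := (subshift beta zeta 0 1 zeta).

Definition point (x y : R) : R[i] := x%:C + y%:C * zeta.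
Definition ycoord (z : R[i]) : R := Im z / Im zeta.
Definition xcoord (z : R[i]) : R := Re z - ycoord z * Re zeta.

Lemma Im_zeta_neq0 : Im zeta != 0.
Proof. by rewrite gt_eqF. Qed.

Lemma beta_gt0 : 0 < beta.
Proof. by move: beta_gt; lra. Qed.

Lemma beta_neq0 : beta != 0.
Proof. by rewrite gt_eqF // beta_gt0. Qed.

Lemma ycoord_point x y : ycoord (point x y) = y.
Proof.
rewrite /ycoord /point; case: zeta Im_zeta_neq0 => a b /= b0.
by rewrite mul0r addr0 add0r mulfK.
Qed.

Lemma xcoord_point x y : xcoord (point x y) = x.
Proof.
rewrite /xcoord ycoord_point /point; case: zeta => a b /=.
by rewrite mul0r subr0 addrK.
Qed.

Lemma point_coords z : z = point (xcoord z) (ycoord z).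
Proof.
rewrite /point /xcoord /ycoord; case: zeta Im_zeta_neq0 => a b /=; case: z => u v /= b0.
by apply/eqP; rewrite eq_complex /= !mul0r addr0 subr0 add0r divfK // subrK !eqxx.
Qed.

Lemma pointD x y x' y' : point x y + point x' y' = point (x + x') (y + y').
Proof. by rewrite /point !rmorphD /= mulrDl addrACA. Qed.

Lemma pointN x y : - point x y = point (- x) (- y).
Proof. by rewrite /point !rmorphN /= mulNr opprD. Qed.

Lemma pointB x y x' y' : point x y - point x' y' = point (x - x') (y - y').
Proof. by rewrite pointN pointD. Qed.

Lemma rot_point x y : rot * point x y = point (- beta * y) (beta * (x + phi * y)).
Proof.
rewrite /point rmorphM rmorphN rmorphM rmorphD rmorphM /=.
transitivity (beta%:C * (x%:C * zeta + y%:C * zeta ^+ 2)); first by ring.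
by rewrite zeta_sqr; ring.
Qed.

Lemma ycoordB z w : ycoord (z - w) = ycoord z - ycoord w.
Proof. by rewrite (point_coords z) (point_coords w) pointB !ycoord_point. Qed.

Lemma xcoordB z w : xcoord (z - w) = xcoord z - xcoord w.
Proof. by rewrite (point_coords z) (point_coords w) pointB !xcoord_point. Qed.

Lemma ycoordZ (c : R) z : ycoord (c%:C * z) = c * ycoord z.
Proof.
have -> : c%:C * z = point (c * xcoord z) (c * ycoord z).
  by rewrite {1}(point_coords z) /point !rmorphM /= mulrDr mulrA.
by rewrite ycoord_point.
Qed.

Lemma xcoordZ (c : R) z : xcoord (c%:C * z) = c * xcoord z.
Proof.
have -> : c%:C * z = point (c * xcoord z) (c * ycoord z).
  by rewrite {1}(point_coords z) /point !rmorphM /= mulrDr mulrA.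
by rewrite xcoord_point.
Qed.

Lemma xcoord_rot z : xcoord (rot * z) = - beta * ycoord z.
Proof. by rewrite {1}(point_coords z) rot_point xcoord_point. Qed.

Lemma ycoord_rot z : ycoord (rot * z) = beta * (xcoord z + phi * ycoord z).
Proof. by rewrite {1}(point_coords z) rot_point ycoord_point. Qed.

Lemma fundomP z : X z <-> (0 <= xcoord z < 1) /\ (0 <= ycoord z < 1).
Proof.
split.
  case=> x /= xI [y /= yI <-]; move: xI yI; rewrite !in_itv /= add0r mulr1.
  by rewrite -/(point x y) xcoord_point ycoord_point.
case=> xI yI; exists (xcoord z); first by rewrite /= in_itv.
exists (ycoord z); first by rewrite /= in_itv.
by rewrite add0r mulr1 -/(point _ _) -point_coords.
Qed.

Definition lattice_point (d : int * int) : R[i] := point d.1%:~R d.2%:~R.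

Lemma latticeP z : lattice 1 zeta z <-> exists d, z = lattice_point d.
Proof.
have E (m n : int) : m%:~R * 1 + n%:~R * zeta = lattice_point (m, n).
  by rewrite /lattice_point /point mulr1 /= !rmorph_int.
split; first by case=> m _ [n _ <-]; exists (m, n).
by case=> -[m n] ->; exists m => //; exists n.
Qed.

Lemma xcoord_lattice_point d : xcoord (lattice_point d) = d.1%:~R.
Proof. exact: xcoord_point. Qed.

Lemma ycoord_lattice_point d : ycoord (lattice_point d) = d.2%:~R.
Proof. exact: ycoord_point. Qed.

Definition digit_coords (z : R[i]) : int * int :=
  (Num.floor (xcoord (rot * z)), Num.floor (ycoord (rot * z))).

Lemma lattice_point_inj : injective lattice_point.
Proof.
move=> [m n] [m' n'] E; move: (congr1 xcoord E) (congr1 ycoord E).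
by rewrite !xcoord_lattice_point !ycoord_lattice_point /= => /intr_inj -> /intr_inj ->.
Qed.

Lemma digitE z : digit z = lattice_point (digit_coords z).
Proof.
have XP d : X (rot * z - lattice_point d) <-> d = digit_coords z.
  rewrite fundomP xcoordB ycoordB xcoord_lattice_point ycoord_lattice_point !floor_frac.
  by case: d => m n /=; split=> [[/eqP -> /eqP ->]|[-> ->]].
rewrite /Defs.digit; apply: xget_unique.
  by split; [apply/latticeP; exists (digit_coords z)|apply/XP].
by move=> _ [/latticeP[d ->] /XP ->].
Qed.

Lemma T_E z : T z = rot * z - lattice_point (digit_coords z).
Proof. by rewrite /Defs.T digitE. Qed.

Lemma T_fundom z : X (T z).
Proof.
apply/fundomP; rewrite T_E xcoordB ycoordB xcoord_lattice_point ycoord_lattice_point.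
by rewrite !floor_frac !eqxx.
Qed.

Lemma iter_T_fundom z n : X z -> X (iter n T z).
Proof. by case: n => // n _; apply: T_fundom. Qed.

(** As [1 / beta < 1], every class modulo [1 / beta] meets [0, 1), so both
    coordinates of a preimage can be found. *)
Lemma T_surj z : X z -> exists2 z', X z' & T z' = z.
Proof.
move=> /fundomP [hx hy].
have b0 := beta_gt0; have bn0 := beta_neq0.
have b1 : 1 < beta by move: beta_gt; lra.
(* The abscissa of z determines the ordinate y' of a preimage modulo 1 / beta;
   then the ordinate of z determines its abscissa x' modulo 1 / beta.  The
   choice in [y'] takes care of the half-open interval. *)
pose y' := if xcoord z == 0 then 0 else (1 - xcoord z) / beta.
have [m [ym y'I]] : exists m : int, - beta * y' = xcoord z + m%:~R /\ 0 <= y' < 1.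
  rewrite /y'; case: eqP => [->|/eqP x0].
    by exists 0; rewrite mulr0 addr0 lexx ltr01.
  exists (- 1); rewrite intrN; split; first by field.
  rewrite divr_ge0 ?ltW //=; last by lra.
  by rewrite ltr_pdivrMr // mul1r; lra.
pose k := Num.floor (beta * phi * y' - ycoord z) + 1.
have kI := floor_itv (beta * phi * y' - ycoord z).
pose x' := (ycoord z + k%:~R) / beta - phi * y'.
have bx : beta * (x' + phi * y') = ycoord z + k%:~R by rewrite /x'; field.
have x'I : 0 <= x' < 1.
  have E : x' = (ycoord z + k%:~R - beta * phi * y') / beta by rewrite /x'; field.
  rewrite E ltr_pdivrMr // mul1r.
  move: kI; rewrite -/k => kI; rewrite intrD in kI.
  rewrite divr_ge0 ?ltW //= /k !intrD; lra.
exists (point x' y'); first by apply/fundomP; rewrite xcoord_point ycoord_point.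
rewrite [LHS]point_coords [RHS]point_coords T_E xcoordB ycoordB xcoord_lattice_point.
rewrite ycoord_lattice_point /digit_coords /= rot_point xcoord_point ycoord_point ym bx.
have fE (x : R) (n : int) : 0 <= x < 1 -> Num.floor (x + n%:~R) = n.
  by move=> xI; apply/esym/eqP; rewrite -floor_frac addrK.
by rewrite !fE // !addrK.
Qed.

(** * Points outside the images and preimages of the boundary *)

Lemma near_ycoord w e : 0 < e -> \forall u \near (w : R[i]^o), `|ycoord u - ycoord w| < e.
Proof.
move=> /(near_real_linear 0 (Im zeta)^-1 w); apply: filterS => u.
by rewrite mul0r add0r /ycoord -mulrBl mulrC.
Qed.

Lemma near_xcoord w e : 0 < e -> \forall u \near (w : R[i]^o), `|xcoord u - xcoord w| < e.
Proof.
move=> /(near_real_linear 1 (- (Re zeta / Im zeta)) w).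
apply: filterS => u; congr (`|_| < _); rewrite /xcoord /ycoord.
by have := Im_zeta_neq0; move=> ?; field.
Qed.

(** The four lines that carry the sides of the rhombus: [(true, c)] stands for
    [x = c] and [(false, c)] for [y = c]. *)
Definition on_side (b : bool * bool) (z : R[i]) : Prop :=
  (if b.1 then xcoord z else ycoord z) = b.2%:R.

Lemma boundary_side z : boundary X z -> exists b, on_side b z.
Proof.
move=> [zc zi].
have clX (f : R[i] -> R) :
    (forall w e, 0 < e -> \forall u \near (w : R[i]^o), `|f u - f w| < e) ->
    (forall u, X u -> 0 <= f u < 1) -> 0 <= f z <= 1.
  move=> nf fX; rewrite !leNgt; apply/andP; split; apply/negP => fz.
    have [|u [Xu]] := zc _ (nf z (- f z) _); first by lra.
    by rewrite /= ltr_norml; have := fX _ Xu; lra.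
  have [|u [Xu]] := zc _ (nf z (f z - 1) _); first by lra.
  by rewrite /= ltr_norml; have := fX _ Xu; lra.
have xz : 0 <= xcoord z <= 1 by apply: clX near_xcoord _ => u /fundomP[].
have yz : 0 <= ycoord z <= 1 by apply: clX near_ycoord _ => u /fundomP[].
have [x0|x0] := eqVneq (xcoord z) 0; first by exists (true, false).
have [x1|x1] := eqVneq (xcoord z) 1; first by exists (true, true).
have [y0|y0] := eqVneq (ycoord z) 0; first by exists (false, false).
have [y1|y1] := eqVneq (ycoord z) 1; first by exists (false, true).
have itv (c : R) : 0 <= c <= 1 -> c != 0 -> c != 1 ->
    exists2 e, 0 < e & forall c', `|c' - c| < e -> 0 <= c' < 1.
  move=> cI c0 c1; have {}cI : 0 < c < 1 by rewrite !lt_neqAle eq_sym c0 c1.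
  exists (Num.min c (1 - c)); first by rewrite lt_min; lra.
  by move=> c'; rewrite lt_min !ltr_norml; lra.
have [e e0 ex] := itv _ xz x0 x1; have [e' e'0 ey] := itv _ yz y0 y1.
exfalso; apply: zi; rewrite /interior /=.
near=> u; apply/fundomP; split; first by apply: ex; near: u; exact: near_xcoord.
by apply: ey; near: u; exact: near_ycoord.
Unshelve. all: by end_near. Qed.

(** Along the perturbation, [beta zeta z - T] stays within a vanishing distance
    of the lattice, and the integers are closed in the reals. *)
Lemma T_perturbed_lattice eta z w : T_perturbed beta zeta 0 1 zeta eta z w ->
  exists d, w = rot * z - lattice_point d.
Proof.
move=> zw; pose W := rot * z - w; pose V := rot * eta.
have int_coord (f : R[i] -> R) (k : int * int -> int) :
    (forall w e, 0 < e -> \forall u \near (w : R[i]^o), `|f u - f w| < e) ->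
    (forall u v, f (u - v) = f u - f v) -> (forall c u, f (c%:C * u) = c * f u) ->
    (forall d, f (lattice_point d) = (k d)%:~R) -> exists m : int, f W = m%:~R.
  move=> nf fB fZ fl; apply: eq_int_of_dist => e e0.
  pose r := e / (2 * (`|f V| + 1)).
  have f0 : 0 < `|f V| + 1 by rewrite ltr_wpDl.
  have r0 : 0 < r by rewrite divr_gt0 // mulr_gt0.
  have [c [c0 cr cw]] : exists c : R,
      [/\ 0 < c, c < r & `|f (T (z - c%:C * eta)) - f w| < e / 2].
    have /nf/zw H : 0 < e / 2 by lra.
    near (0 : R)^'+ => c; exists c; split.
    - by near: c; exact: nbhs_right_gt.
    - by near: c; apply: nbhs_right_lt.
    - by near: c; exact: H.
  exists (k (digit_coords (z - c%:C * eta))); rewrite -fl -fB.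
  have -> : W - lattice_point (digit_coords (z - c%:C * eta)) =
      (T (z - c%:C * eta) - w) - (- c)%:C * V.
    rewrite T_E /W /V rmorphN /=; ring.
  rewrite fB fZ fB; apply: le_lt_trans (ler_normB _ _) _.
  rewrite normrM normrN (gtr0_norm c0).
  have : c * `|f V| <= r * (`|f V| + 1) by apply: ler_pM; rewrite ?normr_ge0 //; lra.
  have -> : r * (`|f V| + 1) = e / 2 by rewrite /r; field; rewrite gt_eqF.
  lra.
have [m mE] := int_coord xcoord fst near_xcoord xcoordB xcoordZ (fun=> xcoord_point _ _).
have [n nE] := int_coord ycoord snd near_ycoord ycoordB ycoordZ (fun=> ycoord_point _ _).
exists (m, n); rewrite /lattice_point /= -mE -nE -point_coords /W; ring.
Unshelve. all: by end_near. Qed.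

Lemma T_image_subset A w : T_image beta zeta 0 1 zeta A w ->
  exists2 z, A z & exists d, w = rot * z - lattice_point d.
Proof.
case=> [[|]|].
- move=> [z [Az Xz] <-]; exists z => //; exists (digit_coords z).
  by rewrite T_E.
- by move=> [z [Az _] /T_perturbed_lattice h]; exists z.
- by move=> [z [Az _] /T_perturbed_lattice h]; exists z.
Qed.

(** An iterate of [T], perturbed or not, as an expanding similarity: the head
    of [ds] is the digit that is subtracted last. *)
Fixpoint act (ds : seq (int * int)) (z : R[i]) : R[i] :=
  if ds is d :: ds' then rot * act ds' z - lattice_point d else z.

Lemma act_diff ds z z' :
  act ds z - act ds z' = rot ^+ size ds * (z - z').
Proof.
elim: ds => [|d ds IH] /=; first by rewrite expr0 mul1r.
by rewrite exprS -[RHS]mulrA -IH; ring.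
Qed.

Lemma T_power_act (n : int) z : T_power beta zeta 0 1 zeta n (boundary X) z ->
  exists ds b, if n is Posz _ then exists2 p, on_side b p & z = act ds p
               else on_side b (act ds z).
Proof.
case: n => n /=.
  elim: n z => [|n IH] z /=.
    by move=> /boundary_side[b bz]; exists [::], b; exists z.
  move=> /T_image_subset[z' /IH[ds [b [p bp ->]]] [d zE]].
  by exists (d :: ds), b, p.
move=> [_ /boundary_side[b bz]].
have [ds dsE] : exists ds, iter n.+1 T z = act ds z.
  elim: n.+1 => [|k [ds IH]]; first by exists [::].
  by exists (digit_coords (iter k T z) :: ds); rewrite /= -IH -T_E.
by exists ds, b; rewrite -dsE.
Qed.

Lemma rot_pow5 : rot ^+ 5 = (beta ^+ 5)%:C.
Proof.
have z3 : zeta ^+ 3 = - phi%:C * (zeta + 1).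
  have -> : zeta ^+ 3 = zeta * zeta ^+ 2 by rewrite -exprS.
  rewrite zeta_sqr.
  have -> : zeta * (phi%:C * zeta - 1) = phi%:C * zeta ^+ 2 - zeta by ring.
  rewrite zeta_sqr.
  have -> : phi%:C * (phi%:C * zeta - 1) - zeta = (phi ^+ 2)%:C * zeta - phi%:C - zeta.
    by rewrite rmorphXn /=; ring.
  by rewrite phi_sqr rmorphB rmorph1 /=; ring.
have z5 : zeta ^+ 5 = 1.
  have -> : zeta ^+ 5 = zeta ^+ 2 * zeta ^+ 3 by rewrite -exprD.
  rewrite z3 zeta_sqr.
  have -> : (phi%:C * zeta - 1) * (- phi%:C * (zeta + 1)) =
     - phi%:C ^+ 2 * (zeta ^+ 2 + zeta) + phi%:C * (zeta + 1) by ring.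
  rewrite zeta_sqr -rmorphXn phi_sqr rmorphB rmorph1 /=.
  have -> : - (1 - phi%:C) * (phi%:C * zeta - 1 + zeta) + phi%:C * (zeta + 1) =
     phi%:C ^+ 2 * zeta - zeta + phi%:C * zeta + 1 by ring.
  by rewrite -rmorphXn phi_sqr rmorphB rmorph1 /=; ring.
by rewrite exprMn z5 mulr1 rmorphXn.
Qed.

Lemma rot_pow5n n : rot ^+ (5 * n) = (beta ^+ (5 * n))%:C.
Proof. by rewrite exprM rot_pow5 -rmorphXn -exprM. Qed.

(** The direction [1 + 2 zeta] of the ray is parallel to no image of a side.  Up
    to a positive factor, its five rotated copies have the coordinates [(1, 2)],
    [(-2, 1 + 2 phi)], [(-1 - 2 phi, - phi)], [(phi, -2 - phi)] and
    [(2 + phi, -1)], none of which vanishes. *)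
Lemma rot_transverse n b : ~ on_side (b, false) (rot ^+ n * point 1 2).
Proof.
have bn0 := beta_neq0.
rewrite (divn_eq n 5) mulnC exprD rot_pow5n -mulrA /on_side /= xcoordZ ycoordZ.
have c0 : beta ^+ (5 * (n %/ 5)) != 0 by rewrite expf_neq0.
have nz (u v : R) : u != 0 -> v != 0 ->
    (if b then beta ^+ (5 * (n %/ 5)) * xcoord (point u v)
     else beta ^+ (5 * (n %/ 5)) * ycoord (point u v)) <> 0%:R.
  by move=> u0 v0; rewrite xcoord_point ycoord_point; case: b; apply/eqP; rewrite mulf_neq0.
have p0 := phi_gt0; have p2 := phi_sqr.
have p3 : phi ^+ 3 = 2 * phi - 1 by rewrite exprS p2 mulrBr -expr2 p2; ring.
have p4 : phi ^+ 4 = 2 - 3 * phi by rewrite exprS p3 mulrBr mulrCA -expr2 p2; ring.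
have step k c u v : rot ^+ k.+1 * point (c * u) (c * v) =
    rot ^+ k * point (beta * c * - v) (beta * c * (u + phi * v)).
  by rewrite exprSr -mulrA (rot_point); congr (_ * point _ _); ring.
have := ltn_pmod n (isT : 0 < 5)%N; move: (n %% 5)%N => k k5.
have -> : point 1 2 = point (1 * 1) (1 * 2) by rewrite !mul1r.
case: k k5 => [|[|[|[|[|//]]]]] _; rewrite ?step expr0 mul1r; apply: nz;
  rewrite !mulf_neq0 ?oner_neq0 // neq_lt; apply/orP;
  first [by left; lra | by right; lra].
Qed.

Lemma on_sideB b z z' : on_side b z -> on_side b z' -> on_side (b.1, false) (z - z').
Proof.
by rewrite /on_side xcoordB ycoordB; case: b => -[] c /= -> ->; rewrite subrr.
Qed.

Definition ray_point (t s : R) : R[i] := point 0 t + s%:C * point 1 2.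

Lemma ray_pointB t s s' : ray_point t s - ray_point t s' = (s - s')%:C * point 1 2.
Proof. by rewrite /ray_point rmorphB /=; ring. Qed.

(** A point of the exceptional set on the ray is encoded by a side and a
    sequence of digits, together with a boolean telling images from preimages.
    By [rot_transverse], the code determines the point. *)
Lemma countable_exceptional_ray t :
  countable [set s | exceptional (ray_point t s)].
Proof.
have bn0 := beta_neq0.
pose P (k : bool * seq (int * int) * (bool * bool)) (s : R) :=
  if k.1.1 then exists2 p, on_side k.2 p & ray_point t s = act k.1.2 p
  else on_side k.2 (act k.1.2 (ray_point t s)).
apply: (@countable_of_code _ _ _ P) => [s [n _ /T_power_act[ds [b]]]|].
  by case: n => n H; [exists (true, ds, b)|exists (false, ds, b)].
move=> [[[] ds] b] s s'; rewrite /P /=; last first.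
  move=> h h'; have := on_sideB h h'; rewrite act_diff ray_pointB mulrCA.
  have := @rot_transverse (size ds) b.1; rewrite /on_side /= xcoordZ ycoordZ.
  move=> nz E; apply/eqP; rewrite -subr_eq0; apply/eqP.
  have [//|s0] := eqVneq (s - s') 0; exfalso; apply: nz.
  by case: b.1 E => /eqP; rewrite mulf_eq0 (negbTE s0) => /eqP.
case=> p bp sE [p' bp' s'E].
have := act_diff ds p p'; rewrite -sE -s'E ray_pointB => E.
apply/eqP; rewrite -subr_eq0; apply/eqP.
have [//|s0] := eqVneq (s - s') 0; exfalso.
apply: (@rot_transverse (4 * size ds) b.1).
(* The direction of the ray has to be rotated back by [zeta ^ - size ds], which
   is [zeta ^ (4 size ds)]. *)
have {}E : (s - s')%:C * (rot ^+ (4 * size ds) * point 1 2) =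
    (beta ^+ (5 * size ds))%:C * (p - p').
  by rewrite -rot_pow5n mulrCA E mulrA -exprD -mulSnr.
have := on_sideB bp bp'; rewrite /on_side /=.
move: (congr1 xcoord E) (congr1 ycoord E); rewrite !xcoordZ !ycoordZ => Ex Ey.
by case: b.1 => h; [move: Ex|move: Ey]; rewrite h mulr0 => /eqP;
  rewrite mulf_eq0 (negbTE s0) => /eqP.
Qed.

Lemma generic_point t (e : R) : 0 < e ->
  exists2 s, 0 < s < e & ~ exceptional (ray_point t s).
Proof.
move=> e0; apply: contrapT => H.
have sub : `]0, e[ `<=` [set s | exceptional (ray_point t s)].
  move=> s /=; rewrite in_itv /= => sI; apply: contrapT => Hs; apply: H.
  by exists s.
have /countable_lebesgue_measure0 :=
  sub_countable (subset_card_le sub) (countable_exceptional_ray t).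
rewrite lebesgue_measure_itv /= lte_fin e0 -EFinD subr0 => -[E].
by rewrite E ltxx in e0.
Qed.

(** * The limit orbit of the left side *)

Lemma rot_iter (u : nat -> R[i]) n :
  (forall i, (i < n)%N -> u i.+1 = rot * u i) -> u n = rot ^+ n * u 0%N.
Proof.
elim: n => [|n IH] H; first by rewrite expr0 mul1r.
by rewrite H // IH ?exprS ?mulrA // => i /ltnW; exact: H.
Qed.

(** Points with a long common word are close: their difference, multiplied by
    [beta^(5k)], is the difference of two points of the rhombus. *)
Lemma common_word_dist z z' k : X z -> X z' ->
  (forall i, (i < 5 * k)%N -> digit_coords (iter i T z) = digit_coords (iter i T z')) ->
  beta ^+ (5 * k) * (xcoord z' - xcoord z) < 1.
Proof.
move=> Xz Xz' H.
have E : iter (5 * k) T z' - iter (5 * k) T z = rot ^+ (5 * k) * (z' - z).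
  apply: (rot_iter (u := fun i => iter i T z' - iter i T z)) => i ik /=.
  by rewrite !T_E H //; ring.
move/(congr1 xcoord): E; rewrite rot_pow5n xcoordZ !xcoordB => <-.
have /fundomP[h _] := iter_T_fundom (5 * k) Xz.
have /fundomP[h' _] := iter_T_fundom (5 * k) Xz'.
lra.
Qed.

Definition limit_digit (z v : R[i]) : int * int :=
  (rfloor (xcoord (rot * z)) (xcoord (rot * v)),
   rfloor (ycoord (rot * z)) (ycoord (rot * v))).

Lemma near_limit_digit z v :
  \forall s \near (0 : R)^'+, digit_coords (z + s%:C * v) = limit_digit z v.
Proof.
near=> s; rewrite /digit_coords.
have -> : rot * (z + s%:C * v) = rot * z - (- s)%:C * (rot * v) by rewrite rmorphN /=; ring.
rewrite xcoordB ycoordB xcoordZ ycoordZ !mulNr !opprK.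
by congr pair; near: s; exact: near_floor.
Unshelve. all: by end_near. Qed.

(** The limit of the [n]-th iterate along the ray; the iterates themselves move
    away from it with velocity [rot ^+ n * point 1 2]. *)
Fixpoint ray_base (t : R) (n : nat) : R[i] :=
  if n is m.+1 then
    rot * ray_base t m
    - lattice_point (limit_digit (ray_base t m) (rot ^+ m * point 1 2))
  else point 0 t.

Definition ray_digit t n : int * int := limit_digit (ray_base t n) (rot ^+ n * point 1 2).
Definition ray_x t n := xcoord (ray_base t n).
Definition ray_y t n := ycoord (ray_base t n).

Lemma ray_baseS t n :
  ray_base t n.+1 = rot * ray_base t n - lattice_point (ray_digit t n).
Proof. by []. Qed.

Lemma ray_xS t n : ray_x t n.+1 = - beta * ray_y t n - (ray_digit t n).1%:~R.
Proof. by rewrite /ray_x ray_baseS xcoordB xcoord_rot xcoord_lattice_point. Qed.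

Lemma ray_yS t n :
  ray_y t n.+1 = beta * (ray_x t n + phi * ray_y t n) - (ray_digit t n).2%:~R.
Proof. by rewrite /ray_y ray_baseS ycoordB ycoord_rot ycoord_lattice_point. Qed.

Lemma ray_y_itv t n : 0 <= t <= 1 -> 0 <= ray_y t n <= 1.
Proof.
case: n => [|n]; first by rewrite /ray_y /= ycoord_point.
by rewrite /ray_y ray_baseS ycoordB ycoord_lattice_point rfloor_itv.
Qed.

Lemma near_ray_orbit t n : \forall s \near (0 : R)^'+,
  iter n T (ray_point t s) = ray_base t n + s%:C * (rot ^+ n * point 1 2).
Proof.
elim: n => [|n IH]; first by near=> s; rewrite /= expr0 mul1r.
near=> s; rewrite iterS.
have -> : iter n T (ray_point t s) = ray_base t n + s%:C * (rot ^+ n * point 1 2).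
  by near: s; exact: IH.
have dE : digit_coords (ray_base t n + s%:C * (rot ^+ n * point 1 2)) = ray_digit t n.
  by near: s; exact: near_limit_digit.
by rewrite T_E dE ray_baseS exprS; ring.
Unshelve. all: by end_near. Qed.

Lemma near_ray_word t n : \forall s \near (0 : R)^'+,
  forall i, (i < n)%N -> digit_coords (iter i T (ray_point t s)) = ray_digit t i.
Proof.
elim: n => [|n IH]; first by near=> s.
near=> s => i; rewrite ltnS leq_eqVlt => /predU1P[->|]; last by move: i; near: s.
have -> : iter n T (ray_point t s) = ray_base t n + s%:C * (rot ^+ n * point 1 2).
  by near: s; exact: near_ray_orbit.
by near: s; exact: near_limit_digit.
Unshelve. all: by end_near. Qed.

(** All points of the rhombus lie to the right of the side [x = 0].  Five steps
    with common digits multiply the horizontal distance to this side by the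
    positive number [beta^5]. *)
Lemma ray_word_xcoord t z k : X z ->
  (forall i, (i < 5 * k)%N -> digit_coords (iter i T z) = ray_digit t i) ->
  ray_x t (5 * k) <= xcoord (iter (5 * k) T z).
Proof.
move=> /fundomP[/andP[zx _] _] H.
have E : iter (5 * k) T z - ray_base t (5 * k) = rot ^+ (5 * k) * (z - point 0 t).
  apply: (rot_iter (u := fun i => iter i T z - ray_base t i)) => i ik.
  by rewrite iterS T_E H // ray_baseS; ring.
move/(congr1 xcoord): E; rewrite rot_pow5n xcoordZ !xcoordB xcoord_point subr0.
rewrite -subr_ge0 => ->.
by rewrite mulr_ge0 // exprn_ge0 // ltW // beta_gt0.
Qed.

(** * Reading the limit orbit in the subshift *)

Lemma exceptional_preimage z z' : X z' -> T z' = z -> exceptional z' -> exceptional z.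
Proof.
move=> Xz' zE [[n|[|n]] _ H].
- by exists (Posz n.+1) => //; left; left; exists z'.
- by exists (Posz 0%N) => //; rewrite -zE; case: H.
- exists (Negz n); [exact: I|split; first by rewrite -zE; exact: T_fundom].
  have {H} [_ H] := H.
  change (boundary X (iter n.+1 T z)); rewrite -zE -iterSr; exact H.
Qed.

(** Non-exceptional points have non-exceptional preimages; an infinite backward
    orbit of [z] provides the letters at negative positions. *)
Lemma subshift_through z : X z -> ~ exceptional z ->
  exists2 w, subshift w & forall n : nat, w n%:Z = expansion z n.
Proof.
move=> Xz gz.
have [pre preP] : exists pre : R[i] -> R[i], forall u, X u -> X (pre u) /\ T (pre u) = u.
  suff : forall u, exists v, X u -> X v /\ T v = u by move=> /choice[f fP]; exists f.
  move=> u; have [Xu|nXu] := pselect (X u); last by exists 0.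
  by have [v Xv Tv] := T_surj Xu; exists v.
pose b k := iter k pre z.
have bP k : X (b k) /\ ~ exceptional (b k).
  elim: k => [//|k [Xb gb]]; have [Xp Tp] := preP _ Xb; split=> //=.
  by move=> /(exceptional_preimage Xp Tp).
have Tb k : T (b k.+1) = b k by have [Xb _] := bP k; have [] := preP _ Xb.
have iterb k i : iter i T (b (k + i)%N) = b k.
  by elim: i => [|i IH]; rewrite ?addn0 // addnS iterSr Tb.
pose w (a : int) := match a with Posz n => expansion z n | Negz k => digit (b k.+1) end.
(* Any point of the backward orbit sees all later letters in its expansion. *)
have wE (K i : nat) : w (i%:Z - K%:Z) = expansion (b K) i.
  rewrite /Defs.expansion; have [Ki|iK] := leqP K i.
    have -> : i%:Z - K%:Z = (i - K)%N%:Z by rewrite subzn.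
    rewrite /= /Defs.expansion -{2}(subnK Ki) iterD.
    by have := iterb 0%N K; rewrite add0n => ->.
  have -> : i%:Z - K%:Z = Negz (K - i).-1 by rewrite NegzE; lia.
  rewrite -[w _]/(digit (b (K - i).-1.+1)).
  rewrite prednK ?subn_gt0 //; congr digit.
  by rewrite -[in RHS](subnK (ltnW iK)) iterb.
have wE' (a : int) : w a = expansion (b (absz a)) (absz (a + (absz a)%:Z)).
  by rewrite -wE; congr w; lia.
exists w => //; split.
  move=> a; rewrite wE' /Defs.expansion; eexists; last by [].
  by apply: iter_T_fundom; case: (bP (absz a)).
move=> j k jk; rewrite /admissible size_map size_iota.
exists (b (absz j)); first by case: (bP (absz j)).
exists (absz (j + (absz j)%:Z)); apply: eq_map => i.
by rewrite -wE; congr w; lia.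
Qed.

Lemma near0_generic t (P : R -> Prop) : (\forall s \near (0 : R)^'+, P s) ->
  exists2 s, P s & ~ exceptional (ray_point t s).
Proof.
move=> /nbhs_ballP[e /= e0 eP].
have [s /andP[s0 se] gs] := generic_point t e0.
exists s => //; apply: eP => //=.
by rewrite -ball_normE /= sub0r normrN gtr0_norm.
Qed.

Section FiniteGraph.
Variables (V E : finType) (src tgt : E -> V) (lab : E -> R[i]).
Hypothesis presents : forall w : int -> R[i],
  subshift w <->
  exists2 p, biinfinite_path src tgt p & forall n, lab (p n) = w n.
Variable t : R.
Hypothesis t_itv : 0 <= t < 1.

Definition reachable n (v : V) : Prop :=
  exists p, [/\ biinfinite_path src tgt p,
                forall i, (i < n)%N -> lab (p i%:Z) = lattice_point (ray_digit t i)
              & src (p n%:Z) = v].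

Definition splice m n (p q : int -> E) (a : int) : E :=
  if a < n%:Z then q a else p (a - n%:Z + m%:Z).

Lemma splice_path m n p q :
  biinfinite_path src tgt p -> biinfinite_path src tgt q ->
  src (p m%:Z) = src (q n%:Z) -> biinfinite_path src tgt (splice m n p q).
Proof.
move=> Pp Pq pq a; rewrite /splice.
case: ifPn => an; case: ifPn => an'; rewrite ?Pq ?Pp.
- by [].
- have aE : a + 1 = n%:Z by lia.
  by rewrite aE subrr add0r pq.
- lia.
- by congr (src (p _)); lia.
Qed.

(** Take a generic point [z] of the ray close to its origin.  Its image [z1]
    after [5 i] steps is as close as desired to the vertical line of abscissa
    [ray_x t (5 * i)].  If the vertices reachable by the first word are
    reachable by the second one, then the second word can be followed by
    arbitrarily long prefixes of the expansion of [z1]; by [ray_word_xcoord] and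
    [common_word_dist], [z1] is arbitrarily close to points on the right of the
    line of abscissa [ray_x t (5 * j)]. *)
Lemma reachable_le i j :
  (forall v, reachable (5 * i) v -> reachable (5 * j) v) ->
  ray_x t (5 * j) <= ray_x t (5 * i).
Proof.
move=> sub; apply/ler_addgt0Pr => e e0; have tI := t_itv.
pose v := rot ^+ (5 * i) * point 1 2.
have [s [[Xz zw zq] se] gz] : exists2 s, [/\ X (ray_point t s),
      forall k, (k < 5 * i)%N -> digit_coords (iter k T (ray_point t s)) = ray_digit t k
      & iter (5 * i) T (ray_point t s) = ray_base t (5 * i) - (- s)%:C * v] /\
     s * xcoord v < e / 2 & ~ exceptional (ray_point t s).
  apply: near0_generic; near=> s.
  have s0 : 0 < s by near: s; exact: nbhs_right_gt.
  have st : s < (1 - t) / 2 by near: s; apply: nbhs_right_lt; lra.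
  split; last first.
    have v0 : 0 < `|xcoord v| + 1 by rewrite ltr_wpDl.
    have sv : s < e / 2 / (`|xcoord v| + 1).
      by near: s; apply: nbhs_right_lt; rewrite !divr_gt0.
    rewrite ltr_pdivlMr // in sv; apply: le_lt_trans sv.
    by rewrite ler_wpM2l ?(ltW s0) // (le_trans (ler_norm _)) // lerDl.
  split.
  - have -> : ray_point t s = point s (t + 2 * s).
      by rewrite /ray_point /point !rmorphD !rmorphM /=; ring.
    by apply/fundomP; rewrite xcoord_point ycoord_point; lra.
  - by near: s; exact: near_ray_word.
  - by rewrite rmorphN mulNr opprK; near: s; exact: near_ray_orbit.
set z := ray_point t s in Xz zw zq gz.
have [w ws wz] := subshift_through Xz gz.
have [p Pp pw] := (presents w).1 ws.
have [|q [Pq qw qv]] := sub (src (p (5 * i)%N%:Z)).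
  by exists p; split=> // k ki; rewrite pw wz /Defs.expansion digitE zw.
set z1 := iter (5 * i) T z in zq.
have Xz1 : X z1 by exact: iter_T_fundom.
have [k kP] : exists k, 2 / e < beta ^+ (5 * k).
  exists (Num.bound (2 / e)); apply: lt_trans (archi_boundP _) _.
    by rewrite divr_ge0 // ltW.
  rewrite exprM; apply: nat_lt_expr; have b2 : 2 <= beta by move: beta_gt; lra.
  by apply: le_trans b2 _; apply: ler_eXnr => //; move: beta_gt; lra.
set Q := splice (5 * i) (5 * j) p q.
have PQ : biinfinite_path src tgt Q by apply: splice_path.
have [_ /(_ 0 (5 * j + 5 * k)%N%:Z isT)] :
    subshift (fun a => lab (Q a)) by apply/presents; exists Q.
rewrite /admissible size_map size_iota subr0 absz_nat => -[z2 [Xz2 _] [m wE]].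
have Xz3 : X (iter m T z2) by exact: iter_T_fundom.
have digQ a : (a < 5 * j + 5 * k)%N ->
    lattice_point (digit_coords (iter a T (iter m T z2))) = lab (Q a%:Z).
  move=> al; rewrite -digitE -iterD addnC.
  have al' : (a < (5 * j + 5 * k).+1)%N by lia.
  have := congr1 (fun l => nth 0 l a) wE; rewrite /block.
  by rewrite subr0 absz_nat !(nth_map 0%N) ?size_iota // !nth_iota // !add0n add0r.
have h1 : ray_x t (5 * j) <= xcoord (iter (5 * j) T (iter m T z2)).
  apply: (ray_word_xcoord Xz3) => a aj.
  apply: lattice_point_inj; rewrite digQ; last by lia.
  by rewrite /Q /splice ltz_nat aj qw.
set z4 := iter (5 * j) T (iter m T z2) in h1.
have : beta ^+ (5 * k) * (xcoord z4 - xcoord z1) < 1.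
  apply: (common_word_dist Xz1) => [|a ak].
    exact: iter_T_fundom.
  apply: lattice_point_inj; rewrite /z4 -iterD addnC digQ; last by lia.
  rewrite /Q /splice ltz_nat ltnNge leq_addr /=.
  have -> : (5 * j + a)%N%:Z - (5 * j)%N%:Z + (5 * i)%N%:Z = (a + 5 * i)%N%:Z by lia.
  by rewrite pw wz /Defs.expansion digitE iterD.
have cz1 : xcoord z1 = ray_x t (5 * i) + s * xcoord v.
  by rewrite zq xcoordB xcoordZ mulNr opprK.
rewrite cz1; set d := xcoord z4 - _ => dk.
have dlt : d < e / 2.
  rewrite ltNge; apply/negP => ed.
  have : 2 / e * (e / 2) <= beta ^+ (5 * k) * d.
    by apply: ler_pM => //; rewrite ?divr_ge0 // ltW.
  have -> : 2 / e * (e / 2) = 1 by field; rewrite gt_eqF.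
  by rewrite leNgt dk.
rewrite /d in dlt; lra.
Unshelve. all: by end_near. Qed.

Lemma ray_orbit_collision : exists i j, (i < j)%N /\ ray_x t (5 * i) = ray_x t (5 * j).
Proof.
pose Term i := [set v | `[< reachable (5 * i) v >]]%SET.
have [i [j [ij TE]]] : exists i j, (i < j)%N /\ Term i = Term j.
  apply: contrapT => H.
  have : injective (fun i : 'I_(#|{set V}|.+1) => Term i).
    move=> i j TE; apply/val_inj/eqP; case: ltngtP => // ij; exfalso; apply: H.
      by exists i, j.
    by exists j, i.
  by move=> /leq_card; rewrite card_ord ltnn.
have R_eq v : reachable (5 * i) v <-> reachable (5 * j) v.
  move/setP: TE => /(_ v); rewrite !inE => h.
  by split=> H; apply/asboolP; [rewrite -h|rewrite h]; apply/asboolP.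
exists i, j; split=> //; apply/eqP; rewrite eq_le.
by apply/andP; split; apply: reachable_le => v /R_eq.
Qed.

End FiniteGraph.

(** * Growth of the conjugate coordinates *)

(** Coordinates of [ray_x] and [ray_y] in the basis [(1, phi)] over the field
    generated by [beta]; the recurrence is that of [ray_xS] and [ray_yS], expanded
    with [phi^2 = 1 - phi]. *)
Fixpoint ray_coefs (t : R) (n : nat) : (R * R) * (R * R) :=
  if n is n'.+1 then
    let: (xa, xb, (ya, yb)) := ray_coefs t n' in
    (- beta * ya - (ray_digit t n').1%:~R, - beta * yb,
     (beta * (xa + yb) - (ray_digit t n').2%:~R, beta * (xb + ya - yb)))
  else (0, 0, (t, 0)).

Definition coef_xa t n := (ray_coefs t n).1.1.
Definition coef_xb t n := (ray_coefs t n).1.2.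
Definition coef_ya t n := (ray_coefs t n).2.1.
Definition coef_yb t n := (ray_coefs t n).2.2.

Lemma ray_coefsE t n :
  ray_x t n = coef_xa t n + phi * coef_xb t n /\
  ray_y t n = coef_ya t n + phi * coef_yb t n.
Proof.
elim: n => [|n [IHx IHy]].
  rewrite /ray_x /ray_y xcoord_point ycoord_point.
  by rewrite /coef_xa /coef_xb /coef_ya /coef_yb /= !mulr0 !addr0.
rewrite ray_xS ray_yS /coef_xa /coef_xb /coef_ya /coef_yb /= IHx IHy.
rewrite /coef_xa /coef_xb /coef_ya /coef_yb.
case: (ray_coefs t n) => [[a b] [c d]] /=; split; first by ring.
have -> : beta * (a + phi * b + phi * (c + phi * d)) =
  beta * (a + phi * b + phi * c + phi ^+ 2 * d) by ring.
by rewrite phi_sqr; ring.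
Qed.

Lemma coef_xbS t n : coef_xb t n.+1 = - beta * coef_yb t n.
Proof. by rewrite /coef_xb /coef_yb /=; case: ray_coefs => [[? ?] [? ?]]. Qed.

(** The unbounded coefficient [coef_ya] is eliminated in favour of [ray_y], which
    lies in [0, 1]. *)
Lemma coef_ybS t n :
  coef_yb t n.+1 = beta * (coef_xb t n + ray_y t n - (1 + phi) * coef_yb t n).
Proof.
rewrite (ray_coefsE t n).2 /coef_ya /coef_xb /coef_yb /=.
by case: ray_coefs => [[? ?] [? ?]] /=; ring.
Qed.

(** The period 5 of the rotation makes the terms in [coef_yb] cancel; with
    [P = 1 + phi] this uses [P^2 = P + 1] only. *)
Lemma coef_xb_step t n : coef_xb t (n + 5) = beta ^+ 5 * (coef_xb t n + ray_y t n)
  - beta ^+ 4 * (1 + phi) * ray_y t n.+1 + beta ^+ 3 * (1 + phi) * ray_y t n.+2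
  - beta ^+ 2 * ray_y t n.+3.
Proof.
have P2 : (1 + phi) ^+ 2 = (1 + phi) + 1 by rewrite sqrrD phi_sqr; ring.
rewrite addnS addn4; move: P2; set P := 1 + phi => P2.
have b1 : coef_yb t n.+1 = beta * (coef_xb t n + ray_y t n - P * coef_yb t n).
  by rewrite coef_ybS.
have b2 : coef_yb t n.+2 = beta * (ray_y t n.+1 - beta * coef_yb t n - P * coef_yb t n.+1).
  by rewrite coef_ybS coef_xbS -/P; ring.
have b3 : coef_yb t n.+3 = beta * (ray_y t n.+2 - beta * coef_yb t n.+1 - P * coef_yb t n.+2).
  by rewrite coef_ybS coef_xbS -/P; ring.
have b4 : coef_yb t n.+4 = beta * (ray_y t n.+3 - beta * coef_yb t n.+2 - P * coef_yb t n.+3).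
  by rewrite coef_ybS coef_xbS -/P; ring.
rewrite coef_xbS b4 b3.
transitivity (- beta ^+ 2 * ray_y t n.+3 + beta ^+ 3 * P * ray_y t n.+2
   - beta ^+ 4 * P * coef_yb t n.+1 + beta ^+ 3 * (1 - P ^+ 2) * coef_yb t n.+2); first by ring.
rewrite P2 b2.
transitivity (- beta ^+ 2 * ray_y t n.+3 + beta ^+ 3 * P * ray_y t n.+2
   - beta ^+ 4 * P * ray_y t n.+1 + beta ^+ 5 * P * coef_yb t n
   + beta ^+ 4 * (P ^+ 2 - P) * coef_yb t n.+1); first by ring.
rewrite P2 b1; ring.
Qed.

Lemma ray_coefs_closed (K : set R) t n :
  GRing.divring_closed [pred x in K] -> beta \in K -> t \in K ->
  coef_xa t n \in K /\ coef_xb t n \in K.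
Proof.
move=> /divring_set[K1 KB KV KD] Kb Kt.
have K0 : 0 \in K by rewrite -(subrr 1); apply: (KB).
have KN x : x \in K -> - x \in K by move=> Kx; rewrite -sub0r; apply: (KB).
have KM x y : x \in K -> y \in K -> x * y \in K.
  by move=> Kx Ky; rewrite -[y]invrK; apply: (KV) => //; rewrite -[y^-1]mul1r; apply: (KV).
have Kn (k : nat) : k%:R \in K by elim: k => [//|k IH]; rewrite -natr1; apply: (KD).
have Kz (m : int) : m%:~R \in K.
  by case: m => k; rewrite ?NegzE ?intrN ?pmulrn; [exact: Kn|apply: (KN); exact: Kn].
suff : [/\ coef_xa t n \in K, coef_xb t n \in K, coef_ya t n \in K & coef_yb t n \in K] by case.
elim: n => [|n]; first by [].
rewrite /coef_xa /coef_xb /coef_ya /coef_yb /=.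
case: ray_coefs => [[a b] [c d]] /= [Ka Kb' Kc Kd].
by split; rewrite ?mulNr; do ?[apply: (KB)|apply: (KD)|apply: (KM)|apply: (KN)].
Qed.

Lemma phi_itv : 1 / 2 < phi < 1.
Proof. by move: phi_gt0 phi_sqr => p0 p2; have := mulr_gt0 p0 p0; rewrite -expr2; nra. Qed.

(** An ordinate in the field generated by [beta] for which [beta phi y] has
    integer part 1 for every [beta]: its value is [2 phi], between 1 and 2.  So
    [ray_y start 1] is explicit, whatever [beta] is. *)
Definition start := 2 / beta.

Lemma start_itv : 0 <= start < 1.
Proof.
have b0 := beta_gt0.
rewrite /start divr_ge0 ?(ltW b0) // ltr_pdivrMr // mul1r; move: beta_gt; lra.
Qed.

Lemma ray_y1 : ray_y start 1 = 2 * phi - 1.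
Proof.
have bn0 := beta_neq0; have := phi_itv => pI.
have E : beta * (ray_x start 0 + phi * ray_y start 0) = 2 * phi.
  by rewrite /ray_x /ray_y xcoord_point ycoord_point add0r /start; field.
have F b : rfloor (2 * phi) b = 1 by apply: rfloor_eq; rewrite mulr1z; lra.
by rewrite ray_yS /= ycoord_rot E F mulr1z.
Qed.

(** For [j = 0], the first two terms of [coef_xb_step] add up to
    [beta^4 (1 + phi)].  From then on [beta^5 * coef_xb] dominates the terms in
    [ray_y]. *)
Lemma conjugate_growth j :
  2 <= coef_xb start (5 * j.+1) /\ coef_xb start (5 * j) < coef_xb start (5 * j.+1).
Proof.
have /andP[p_half p_lt1] := phi_itv; have b0 := beta_gt0.
have bt := beta_gt; have bn0 := beta_neq0.
have tI : 0 <= start <= 1 by have := start_itv; lra.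
have q8 : 8 <= beta ^+ 2 by rewrite expr2; have := ltr_pM _ _ bt bt; nra.
set q := beta ^+ 2 in q8.
have sq (c : R) : 0 <= c -> 8 * c <= q * c by move=> c0; rewrite ler_wpM2r.
have err n : - q <= beta ^+ 3 * (1 + phi) * ray_y start n.+2 - q * ray_y start n.+3.
  have /andP[y2 _] := ray_y_itv n.+2 tI; have /andP[_ y3] := ray_y_itv n.+3 tI.
  have : 0 <= beta ^+ 3 * (1 + phi) * ray_y start n.+2.
    by apply: mulr_ge0 => //; apply: mulr_ge0; [rewrite exprn_ge0 ?(ltW b0)|lra].
  have : q * ray_y start n.+3 <= q * 1 by rewrite ler_wpM2l //; lra.
  lra.
have mulS k : (5 * k.+1 = 5 * k + 5)%N by rewrite mulnS addnC.
elim: j => [|j [IH _]].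
  rewrite mulS muln0 coef_xb_step ray_y1.
  have -> : coef_xb start 0 = 0 by [].
  have -> : ray_y start 0 = start by rewrite /ray_y ycoord_point.
  have := err 0%N; rewrite -/q.
  have -> : beta ^+ 5 * (0 + start) - beta ^+ 4 * (1 + phi) * (2 * phi - 1) =
      q * (q * (1 + phi)).
    have -> : beta ^+ 5 * (0 + start) - beta ^+ 4 * (1 + phi) * (2 * phi - 1) =
      q * q * (3 - phi - 2 * phi ^+ 2) by rewrite /q /start; field.
    by rewrite phi_sqr; ring.
  have := sq (1 + phi) ltac:(lra); have := sq (q * (1 + phi) - 1); lra.
rewrite [in X in _ < X]mulS mulS coef_xb_step -/q; set B := coef_xb start _ in IH *.
have /andP[y0 _] := ray_y_itv (5 * j.+1) tI.
have /andP[_ y1] := ray_y_itv (5 * j.+1).+1 tI.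
have := err (5 * j.+1)%N.
have y0' : 0 <= beta ^+ 5 * ray_y start (5 * j.+1) by rewrite mulr_ge0 ?exprn_ge0 ?(ltW b0).
have y1' : beta ^+ 4 * (1 + phi) * ray_y start (5 * j.+1).+1 <= beta ^+ 4 * (1 + phi) * 1.
  by rewrite ler_wpM2l // mulr_ge0 ?exprn_ge0 ?(ltW b0) //; lra.
have bB : 29 / 10 * B <= beta * B by rewrite ler_wpM2r //; lra.
have E5 : beta ^+ 5 * B - beta ^+ 4 * (1 + phi) * 1 = q * (q * (beta * B - (1 + phi))).
  by rewrite /q; ring.
rewrite mulrDr.
have := sq (beta * B - (1 + phi)) ltac:(lra).
have := sq (q * (beta * B - (1 + phi)) - 1).
lra.
Qed.

Lemma conjugate_lt i j : (i < j)%N -> coef_xb start (5 * i) < coef_xb start (5 * j).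
Proof.
apply: (@homo_ltn _ (fun i => coef_xb start (5 * i)) <%R) => [x y z|k].
  exact: lt_trans.
by case: (conjugate_growth k).
Qed.

(** A coincidence with distinct coefficients of [phi] would express [phi] in the
    field. *)
Lemma ray_orbit_no_collision (K : set R) i j :
  GRing.divring_closed [pred x in K] -> beta \in K -> phi \notin K ->
  (i < j)%N -> ray_x start (5 * i) <> ray_x start (5 * j).
Proof.
move=> KF Kb Kphi ij; have [K1 KB KV KD] := divring_set KF.
rewrite !(ray_coefsE _ _).1 => E.
have startK : start \in K.
  by apply: (KV) => //; apply: (KD).
have [Ai Bi] := ray_coefs_closed (5 * i) KF Kb startK.
have [Aj Bj] := ray_coefs_closed (5 * j) KF Kb startK.
have lt := conjugate_lt ij.
case/negP: Kphi.
have -> : phi = (coef_xa start (5 * i) - coef_xa start (5 * j)) /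
    (coef_xb start (5 * j) - coef_xb start (5 * i)).
  have dn0 : coef_xb start (5 * j) - coef_xb start (5 * i) != 0 by rewrite subr_eq0 gt_eqF.
  apply: (mulIf dn0); rewrite divfK //; lra.
by apply: (KV); apply: (KB).
Qed.

End PentagonalTransformation.

Unset Implicit Arguments.

Theorem theorem1p7 (R : realType) (beta : R) (zeta : R[i]) :
  zeta = expi (2 * pi / 5) ->
  2 + 903 / 10 ^+ 3 + 32 / 10 ^+ 5 < beta ->
  ~ adjoinQ beta (Num.sqrt 5) ->
  ~ sofic beta zeta 0 1 zeta.
Proof.
move=> zE beta_large sqrt5_notin [V [E [src [tgt [lab [_ presents]]]]]].
have beta_gt : 29 / 10 < beta by move: beta_large; lra.
pose phi := 2 * cos (2 * pi / 5 : R).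
have phi_gt0 : 0 < phi by rewrite mulr_gt0 // cos_pentagon_gt0.
have phi_sqr : phi ^+ 2 = 1 - phi := golden_sqr R.
have zeta_sqr : (zeta ^+ 2 = phi%:C * zeta - 1)%C by rewrite zE expi_pentagon_sqr.
have Im_zeta : 0 < complex.Im zeta by rewrite zE sin_pentagon_gt0.
have [i [j [ij collision]]] := ray_orbit_collision phi_gt0 phi_sqr zeta_sqr
  Im_zeta beta_gt presents (start_itv beta_gt).
apply: sqrt5_notin => K [KF Kbeta].
have Kb : beta \in K by rewrite inE; exact: Kbeta.
apply: contrapT => K5.
apply: (ray_orbit_no_collision phi_gt0 phi_sqr zeta_sqr Im_zeta beta_gt KF Kb _ ij collision).
apply/negP => Kphi; apply: K5.
have [K1 KB KV KD] := divring_set KF.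
have -> : Num.sqrt 5 = 2 * phi + 1.
  have -> : 5 = (2 * phi + 1) ^+ 2 :> R by rewrite sqrrD exprMn phi_sqr; ring.
  by rewrite sqrtr_sqr ger0_norm //; lra.
by rewrite mulr_natl mulr2n -in_setE; do 2?apply: (KD).
Qed.
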